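(* Let $p$ be an odd prime, and assume that $2$ has order $g$ in the multiplicative group $\mathbb{Z}_p^*$ where $g$ is even. Let $n=2^{b}+2^{a}$ where $b>a\ge 0$ are integers and $n>2p-1$. If $a\equiv b\equiv g/2 \bmod g$, then $2^{a}$ is non-essential for $n$ in base $p$. Furthermore, the element $2p-1$ is non-essential for $n$ in both base $2$ and base $p$. Hence $\Phi_{2p}$ is a factor of $Q_{n}(t)$.
   Context: For $S\subseteq[n-1]=\{1,\dots,n-1\}$ let $\beta_n(S)$ be the number of permutations $\pi\in\mathfrak{S}_n$ with descent set $\{i\in[n-1] : \pi_i>\pi_{i+1}\}$ equal to $S$. The $n$th descent set polynomial is $Q_n(t)=\sum_{S\subseteq[n-1]}t^{\beta_n(S)}$. $\Phi_m(t)$ denotes the $m$th cyclotomic polynomial; factors are in $\mathbb{Q}[t]$. For a prime $\ell$ and $1\le k\le n-1$, write $n=\sum_i n_i\ell^i$, $k=\sum_i k_i\ell^i$ with $0\le n_i,k_i<\ell$; $k$ is essential for $n$ in base $\ell$ if $k_i\le n_i$ for all $i$, and non-essential otherwise. *)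

(* Defs.v *)
From HB Require Import structures.
From mathcomp Require Import all_boot all_order all_algebra all_fingroup all_field.

Set Implicit Arguments.
Unset Strict Implicit.
Unset Printing Implicit Defensive.

Import GRing.Theory.

(* The element i of [n-1] = {1, ..., n-1} is encoded as the ordinal i : 'I_n
   with 0 < i.  Since permutations act on {0, ..., n-1}, the one-based entries
   pi_i and pi_(i+1) are s (i-1) and s i. *)
Definition positions (n : nat) : {set 'I_n} := [set i : 'I_n | 0 < i].

Definition descent_set (n : nat) (s : 'S_n) : {set 'I_n} :=
  [set i : 'I_n | [exists j : 'I_n, (j.+1 == i) && (s i < s j)]].

Definition descent_number (n : nat) (S : {set 'I_n}) : nat :=
  #|[set s : 'S_n | descent_set s == S]|.

Definition descent_set_poly (n : nat) : {poly rat} :=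
  (\sum_(S : {set 'I_n} | S \subset positions n) 'X^(descent_number S))%R.

Definition digit (l n i : nat) : nat := n %/ l ^ i %% l.

Definition essential (l n k : nat) : Prop :=
  0 < k < n /\ forall i, digit l k i <= digit l n i.

Definition nonessential (l n k : nat) : Prop :=
  0 < k < n /\ ~ essential l n k.

Definition cyclotomic_rat (m : nat) : {poly rat} := map_poly intr 'Phi_m.

(* Main.v *)
(** Adding the descent numbers of S and of S with the membership of x toggled
    counts the permutations whose descent set agrees with S off x.  These are
    given by the set of their first x values and by the patterns of their two
    halves, whence
      beta_n(S) + beta_n(S toggled at x) = 'C(n, x) beta_x(S1) beta_(n-x)(S2).
    By Lucas, this is 0 modulo l when x is non-essential in base l; and it is odd
    when n = 2^b + 2^a and x = 2^a, since 'C(n, x) is odd and so are all descent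
    numbers of a power of 2.  Toggling both 2^a and 2p - 1 is therefore an
    involution which preserves beta_n modulo p and flips its parity; it groups
    Q_n into pairs t^u + t^v with v - u an odd multiple of p, divisible by
    t^p + 1 and so by Phi_(2p). *)

Require Import Defs.
From HB Require Import structures.
From mathcomp Require Import all_boot all_order all_algebra all_fingroup all_field.
Set Implicit Arguments.
Unset Strict Implicit.
Unset Printing Implicit Defensive.
Import GRing.Theory.

(** * Binomial coefficients modulo a prime *)

(** By absorption, [l ^ e] divides [i * 'C(l ^ e, i)]; were the binomial prime to [l], it would
    divide the smaller number [i]. *)
Lemma dvdn_bin_pfactor (l e i : nat) :
  prime l -> 0 < i < l ^ e -> l %| 'C(l ^ e, i).
Proof.
move=> l_prime /andP[i_gt0 lt_i]; apply/negPn/negP => l_bin.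
have: l ^ e %| i * 'C(l ^ e, i).
  by case: i i_gt0 {lt_i l_bin} => // i _; rewrite -mul_bin_diag dvdn_mulr.
rewrite Gauss_dvdl; first by move/(dvdn_leq i_gt0); rewrite leqNgt lt_i.
by rewrite coprimeXl // prime_coprime.
Qed.

(* (1 + X)^(P+n) = (1 + X^P) (1 + X)^n modulo l, for P a power of l. *)
Lemma bin_add_pfactor (l e n k : nat) : prime l ->
  'C(l ^ e + n, k) = 'C(n, k) + (l ^ e <= k) * 'C(n, k - l ^ e) %[mod l].
Proof.
move=> l_prime; set P := l ^ e.
have P_gt0 : 0 < P by rewrite expn_gt0 prime_gt0.
have mid i : 0 < i < P -> 'C(P, i) = 0 %[mod l].
  by move=> iP; apply/eqP; rewrite mod0n; apply: dvdn_bin_pfactor.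
(* Modulo [l], only the terms of index 0 and [P] survive in Vandermonde's sum. *)
rewrite -binomial.Vandermonde big_ord_recl /= bin0 mul1n subn0.
apply/eqP; rewrite eqn_modDl; apply/eqP.
case: leqP => [le_Pk | lt_kP]; last first.
  apply/eqP; rewrite mod0n; apply: dvdn_sum => i _.
  apply: dvdn_mulr; apply: dvdn_bin_pfactor => //=.
  by rewrite (leq_ltn_trans _ lt_kP) // /bump.
have lt_P1k : P.-1 < k by rewrite prednK.
rewrite mul1n (bigD1 (Ordinal lt_P1k)) //= /bump add1n prednK // binn mul1n.
apply/eqP; rewrite -{2}['C(n, k - P)]addn0 eqn_modDl mod0n.
apply: dvdn_sum => i; rewrite -val_eqE /= => neq_i.
apply: dvdn_mulr; rewrite add1n; have [lt_iP | le_Pi] := ltnP i.+1 P.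
  exact: dvdn_bin_pfactor.
rewrite bin_small // ltn_neqAle le_Pi andbT.
by apply: contraNneq neq_i => ->.
Qed.

(** The case of Lucas's theorem that is needed. Removing copies of [l ^ e] from [n] keeps both
    residues, until [n] is its own residue; then [n < k] and the binomial vanishes. *)
Lemma dvdn_bin_ltn_mod (l e n k : nat) :
  prime l -> n %% l ^ e < k %% l ^ e -> l %| 'C(n, k).
Proof.
move=> l_prime; set P := l ^ e; rewrite {2}(divn_eq n P).
move: (n %/ P) (n %% P) => q r; elim: q k => [|q IHq] k lt_rk.
  by rewrite mul0n add0n bin_small // (leq_trans lt_rk) ?leq_mod.
rewrite mulSn -addnA /dvdn bin_add_pfactor // -/(dvdn _ _) dvdn_addr ?IHq //.
by case: leqP => // le_Pk; rewrite mul1n IHq // -(modnDr _ P) subnK.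
Qed.

(** * Cyclotomic factors and multiplicative order *)

(** Cancelling ['X^m - 1] from the factorization of ['X^(2 * m) - 1] leaves the ['Phi_d] with [d]
    dividing [2 * m] but not [m]; one of these is [d = 2 * m]. *)
Lemma cyclotomic_rat_dvd_XnD1 (m : nat) :
  0 < m -> (cyclotomic_rat (2 * m) %| 'X^m + 1)%R.
Proof.
move=> m_gt0; have mm_gt0 : 0 < 2 * m by rewrite muln_gt0.
have XnB1_neq0 : ('X^m - 1 : {poly int})%R != 0%R.
  by rewrite -size_poly_eq0 size_XnsubC.
have XnD1E : ('X^m + 1)%R =
    (\prod_(d <- divisors (2 * m) | ~~ dvdn d m) 'Phi_d)%R.
  apply: (mulfI XnB1_neq0); have := prod_Cyclotomic mm_gt0.
  rewrite (bigID (fun d => dvdn d m)) /= -subr_sqr expr1n -exprM (mulnC m).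
  move=> <-.
  rewrite -(prod_Cyclotomic m_gt0) -big_filter; congr (_ * _)%R.
  apply: perm_big; apply: uniq_perm => [||d].
  - by rewrite filter_uniq ?divisors_uniq.
  - exact: divisors_uniq.
  rewrite mem_filter -(dvdn_divisors _ m_gt0) -(dvdn_divisors _ mm_gt0).
  by apply: andb_idr => /dvdn_mull->.
have ndvd_mm : ~~ (2 * m %| m)%N.
  by rewrite gtnNdvd // -[X in X < _]mul1n ltn_pmul2r.
have -> : ('X^m + 1 = map_poly intr ('X^m + 1 : {poly int}) :> {poly rat})%R.
  by rewrite rmorphD rmorph1 /= map_polyXn.
rewrite XnD1E -big_filter (bigD1_seq (2 * m)) ?filter_uniq ?divisors_uniq //=.
  by rewrite rmorphM dvdp_mulr.
by rewrite mem_filter ndvd_mm -dvdn_divisors ?dvdnn.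
Qed.

Lemma modn_expn_eq1 (p k : nat) (u : {unit 'F_p}) (c : nat) :
  prime p -> FinRing.uval u = c%:R%R -> (c ^ k == 1 %[mod p]) = (#[u]%g %| k).
Proof.
move=> p_prime uE; rewrite cyclic.order_dvdn -val_eqE /=.
by rewrite FinRing.val_unitX /= uE -natrX -val_eqE /= val_Fp_nat // Fp_cast.
Qed.

(** * Ranks and standardization *)

Definition rank_in (n : nat) (A : {set 'I_n}) (x : 'I_n) : nat :=
  #|[set y in A | y < x]|.

Lemma ltn_rank_in (n : nat) (A : {set 'I_n}) (x y : 'I_n) :
  x \in A -> (rank_in A x < rank_in A y) = (x < y).
Proof.
move=> Ax; have mono (u v : 'I_n) : u <= v -> rank_in A u <= rank_in A v.
  move=> le_uv; apply/subset_leq_card/subsetP => w.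
  rewrite !inE => /andP[-> /=].
  by move=> lt_wu; apply: leq_trans le_uv.
have [lt_xy | le_yx] := ltnP x y; last by rewrite ltnNge mono.
apply/proper_card/properP; split; last by exists x; rewrite !inE ?Ax ?ltnn.
apply/subsetP => w; rewrite !inE => /andP[-> /=] lt_wx.
exact: ltn_trans lt_xy.
Qed.

Lemma rank_in_inj (n : nat) (A : {set 'I_n}) : {in A &, injective (rank_in A)}.
Proof.
move=> x y Ax Ay eq_xy; apply/val_inj/eqP.
rewrite eqn_leq leqNgt -(ltn_rank_in x Ay) eq_xy ltnn.
by rewrite leqNgt -(ltn_rank_in y Ax) eq_xy ltnn.
Qed.

Section Standardization.

Variables (n k : nat) (f : 'I_k -> 'I_n).
Hypothesis f_inj : injective f.

Fact std_subproof (i : 'I_k) : rank_in (f @: setT) (f i) < k.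
Proof.
rewrite -[X in _ < X]card_ord -cardsT -(card_imset _ f_inj).
apply/proper_card/properP; split.
  by apply/subsetP => y; rewrite inE => /andP[].
by exists (f i); rewrite ?imset_f ?inE // ltnn andbF.
Qed.

Fact std_inj : injective (fun i => Ordinal (std_subproof i)).
Proof.
move=> i j /(congr1 val) /= /rank_in_inj eq_ij; apply/f_inj/eq_ij;
exact: imset_f.
Qed.

(** The pattern of the word [f]: each entry is replaced by its rank, from 0, among the entries. *)
Definition std : 'S_k := perm std_inj.

Lemma std_rank (i : 'I_k) : std i = rank_in (f @: setT) (f i) :> nat.
Proof. by rewrite permE. Qed.

Lemma ltn_std (i j : 'I_k) : (std i < std j) = (f i < f j).
Proof. by rewrite !std_rank ltn_rank_in ?imset_f. Qed.

End Standardization.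

(** * Cutting a permutation after its first [k] entries *)

Section Split.

Variables k m : nat.
Implicit Type s : 'S_(k + m).

Definition lvalues s : {set 'I_(k + m)} := (s \o @lshift k m) @: setT.
Definition rvalues s : {set 'I_(k + m)} := (s \o @rshift k m) @: setT.

Lemma lperm_inj s : injective (s \o @lshift k m).
Proof. exact/inj_comp/lshift_inj/perm_inj. Qed.
Lemma rperm_inj s : injective (s \o @rshift k m).
Proof. exact/inj_comp/rshift_inj/perm_inj. Qed.

Definition lstd s : 'S_k := std (@lperm_inj s).
Definition rstd s : 'S_m := std (@rperm_inj s).

Lemma rvaluesE s : rvalues s = ~: lvalues s.
Proof.
apply/setP => x; rewrite inE; apply/imsetP/idP => [[j _ ->]|nx].
  by apply/imsetP => -[i _] /perm_inj/eqP; rewrite eq_shift.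
case: (split_ordP (s^-1%g x)) => [i|j] xE; last first.
  by exists j; rewrite //= -xE permKV.
by case/imsetP: nx; exists i; rewrite //= -xE permKV.
Qed.

Lemma card_lvalues s : #|lvalues s| = k.
Proof. by rewrite card_imset ?cardsT ?card_ord //; apply: lperm_inj. Qed.

(* A permutation is determined by the set of its first k values and the relative
   orders of its first k and last m values. *)
Definition perm_split s := (lvalues s, (lstd s, rstd s)).

Lemma perm_split_inj : injective perm_split.
Proof.
move=> s t [] eqA /permP eql /permP eqr.
have eqB : rvalues s = rvalues t by rewrite !rvaluesE eqA.
apply/permP => x; case: (split_ordP x) => [i | j] ->.
  have := congr1 (@nat_of_ord k) (eql i); rewrite !std_rank -!/(lvalues _) -eqA.
  by apply: rank_in_inj; [|rewrite eqA]; apply/imsetP; exists i.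
have := congr1 (@nat_of_ord m) (eqr j); rewrite !std_rank -!/(rvalues _) -eqB.
by apply: rank_in_inj; [|rewrite eqB]; apply/imsetP; exists j.
Qed.

Lemma perm_split_imset (D : {set 'S_k}) (E : {set 'S_m}) :
  perm_split @: [set s | (lstd s \in D) && (rstd s \in E)] =
    setX [set A : {set 'I_(k + m)} | #|A| == k] (setX D E).
Proof.
(* An injection between sets of equal size is onto; the sizes agree because (k+m)! = C(k+m, k) k!
   m!. *)
have full : perm_split @: setT =
    setX [set A : {set 'I_(k + m)} | #|A| == k] setT.
  apply/eqP; rewrite -(subset_leqif_cards _); last first.
    apply/subsetP => _ /imsetP[s _ ->]; by rewrite !inE /= card_lvalues eqxx.
  rewrite card_imset; last exact: perm_split_inj.
  rewrite cardsX card_draws card_ord !cardsT card_prod !card_Sn.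
  by rewrite -[in (k + m)`!](bin_fact (leq_addr m k)) addKn.
apply/setP => -[A [u v]]; apply/imsetP/idP => [[s + ->]|].
  by rewrite !inE /= card_lvalues eqxx.
rewrite !inE /= => /andP[Ak uvP].
have : (A, (u, v)) \in perm_split @: setT by rewrite full !inE /= Ak.
case/imsetP => s _ AuvE; exists s => //; rewrite inE.
by move: AuvE uvP => [_ -> ->].
Qed.

Lemma card_perm_split (D : {set 'S_k}) (E : {set 'S_m}) :
  #|[set s | (lstd s \in D) && (rstd s \in E)]| = 'C(k + m, k) * (#|D| * #|E|).
Proof.
rewrite -(card_imset _ perm_split_inj) perm_split_imset !cardsX card_draws.
by rewrite card_ord.
Qed.

Lemma lstd_descent s (i : 'I_k) :
  (i \in descent_set (lstd s)) = (lshift m i \in descent_set s).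
Proof.
rewrite !inE; apply/existsP/existsP => -[j /andP[/eqP ji]].
  by rewrite ltn_std => lt_ij; exists (lshift m j); rewrite /= ji eqxx.
case: (split_ordP j) ji => [j' -> /= ji lt_ij | j' -> /= ji _].
  by exists j'; rewrite ji eqxx ltn_std.
by have := ltn_ord i; rewrite -ji ltnNge (leq_trans (leq_addr j' k)).
Qed.

(** At [i = 0] the descent of [s] would compare entries from different halves, which the pattern of
    the right half does not see. *)
Lemma rstd_descent s (i : 'I_m) : 0 < i ->
  (i \in descent_set (rstd s)) = (rshift k i \in descent_set s).
Proof.
move=> i_gt0; rewrite !inE; apply/existsP/existsP => -[j /andP[/eqP ji]].
  by rewrite ltn_std => lt_ij; exists (rshift k j); rewrite /= -ji addnS eqxx.
case: (split_ordP j) ji => [j' -> /= ji _ | j' -> /= ji lt_ij].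
  by have := ltn_ord j'; rewrite ji -[X in _ <= X]addn0 leq_add2l leqNgt i_gt0.
by exists j'; rewrite ltn_std lt_ij -(eqn_add2l k) -ji addnS eqxx.
Qed.

End Split.

(** * Toggling a position of the descent set *)

Lemma descent_gt0 n (s : 'S_n) (i : 'I_n) : i \in descent_set s -> 0 < i.
Proof. by rewrite inE => /existsP[j /andP[/eqP<-]]. Qed.

Definition toggle (T : finType) (x : T) (S : {set T}) : {set T} :=
  if x \in S then S :\ x else x |: S.

Lemma in_toggle (T : finType) (x y : T) (S : {set T}) :
  (y \in toggle x S) = (y == x) (+) (y \in S).
Proof.
rewrite /toggle; case: ifP => xS; rewrite !inE; case: eqP => // ->;
by rewrite xS.
Qed.

Lemma toggleK (T : finType) (x : T) : involutive (toggle x).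
Proof. by move=> S; apply/setP=> y; rewrite !in_toggle addKb. Qed.

Lemma toggleC (T : finType) (x y : T) (S : {set T}) :
  toggle x (toggle y S) = toggle y (toggle x S).
Proof. by apply/setP=> z; rewrite !in_toggle addbCA. Qed.

Lemma toggle_positions n (x : 'I_n) (S : {set 'I_n}) :
  0 < x -> (toggle x S \subset positions n) = (S \subset positions n).
Proof.
move=> x_gt0.
suff sub (A : {set 'I_n}) :
    A \subset positions n -> toggle x A \subset positions n.
  by apply/idP/idP => /sub //; rewrite toggleK.
move/subsetP=> subA; apply/subsetP => y; rewrite in_toggle inE.
by case: eqP => [->// | _ /subA]; rewrite inE.
Qed.

(** The only sets that agree with [S] off [x] are [S] and [toggle x S]. *)
Lemma descent_number_toggle n (x : 'I_n) (S : {set 'I_n}) :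
  descent_number S + descent_number (toggle x S) =
    #|[set s : 'S_n | descent_set s :\ x == S :\ x]|.
Proof.
rewrite -(cardsID [set s | descent_set s == S]); congr (_ + _).
  by apply: eq_card => s; rewrite !inE andb_idl // => /eqP->.
apply: eq_card => s; rewrite !inE.
apply/eqP/andP => [-> | [neq_sS /eqP/setP eq_sS]].
  split; last by apply/eqP/setP => y; rewrite !in_setD1 in_toggle; case: eqP.
  by apply/eqP => /setP/(_ x); rewrite in_toggle eqxx; case: (x \in S).
apply/setP => y; rewrite in_toggle; have := eq_sS y; rewrite !in_setD1.
case: eqP => //= -> _; apply: contraNeq neq_sS => neq_x.
apply/eqP/setP => z; have := eq_sS z; rewrite !in_setD1.
by case: eqP => //= -> _; move: neq_x; do 2 case: (x \in _).
Qed.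

Lemma descent_number_split k m (x : 'I_(k + m)) (S : {set 'I_(k + m)}) :
  x = k :> nat -> S \subset positions (k + m) ->
  exists (S1 : {set 'I_k}) (S2 : {set 'I_m}),
  [/\ S1 \subset positions k, S2 \subset positions m &
   descent_number S + descent_number (toggle x S) =
     'C(k + m, k) * (descent_number S1 * descent_number S2)].
Proof.
move=> xE /subsetP S_pos; exists [set i | lshift m i \in S].
(* The condition [0 < i] discards the cut position [x], where the descent is left free. *)
exists [set i : 'I_m | (0 < i) && (rshift k i \in S)]; split.
- by apply/subsetP => i; rewrite inE => /S_pos; rewrite !inE.
- by apply/subsetP => i; rewrite !inE => /andP[].
rewrite descent_number_toggle /descent_number -card_perm_split.
apply: eq_card => s; rewrite !inE.
apply/eqP/andP => [/setP eq_sS | [/eqP/setP eql /eqP/setP eqr]].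
  split; apply/eqP/setP => i; rewrite [in RHS]inE.
    have := eq_sS (lshift m i).
    by rewrite lstd_descent !in_setD1 -val_eqE /= xE ltn_eqF.
  have [i0 | i_gt0] := posnP i.
    by apply/negP => /descent_gt0; rewrite i0.
  have := eq_sS (rshift k i); rewrite rstd_descent // !in_setD1 -val_eqE /= xE.
  by rewrite -[X in _ == X]addn0 eqn_add2l -lt0n i_gt0.
apply/setP => y; rewrite !in_setD1; case: (split_ordP y) => [i | i] ->.
  by have := eql i; rewrite lstd_descent [in RHS]inE => ->.
rewrite -val_eqE /= xE -[X in _ == X]addn0 eqn_add2l -lt0n.
case: posnP => // i_gt0; have := eqr i.
by rewrite rstd_descent // [in RHS]inE i_gt0.
Qed.

Lemma descent_number_set0 n : descent_number (set0 : {set 'I_n}) = 1.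
Proof.
rewrite -(cards1 (1%g : 'S_n)); apply: eq_card => s; rewrite !inE.
apply/eqP/eqP => [/setP no_descent | ->]; last first.
  apply/setP => i; rewrite !inE; apply/existsP => -[j]; rewrite !perm1.
  by move=> /andP[/eqP<-]; rewrite ltnNge leqnSn.
(* Without descents [s] is increasing, hence [i <= s i]; as both sides have the same sum over all
   [i], equality holds throughout. *)
have s_ge (i : 'I_n) : i <= s i.
  case: i; elim=> [//|i IHi] lt_in; set x := Ordinal lt_in.
  have lt_i := ltnW lt_in; apply: leq_ltn_trans (IHi lt_i) _.
  have := no_descent x; rewrite !inE => /existsPn/(_ (Ordinal lt_i)).
  rewrite /= eqxx -leqNgt leq_eqVlt => /predU1P[|//].
  by move/val_inj/perm_inj/(congr1 val)/n_Sn.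
have /leqif_sum[_ sumE] (i : 'I_n) : true -> i <= s i ?= iff (s i == i).
  by move=> _; split; rewrite // -val_eqE eq_sym.
move: sumE; rewrite [X in X == _](reindex_perm s) /= eqxx.
move/esym/forallP => s_id; apply/permP => i; rewrite perm1; exact/eqP/s_id.
Qed.

Lemma nat_ord_split n (x : 'I_n) (S : {set 'I_n}) : S \subset positions n ->
  exists (S1 : {set 'I_x}) (S2 : {set 'I_(n - x)}),
  [/\ S1 \subset positions x, S2 \subset positions (n - x) &
   descent_number S + descent_number (toggle x S) =
     'C(n, x) * (descent_number S1 * descent_number S2)].
Proof.
have: n = x + (n - x) by rewrite subnKC // ltnW.
(* Both parts become variables, so that [n] can be replaced by [k + m] in the types. *)
move: (n - x) => m; move: {-2}(nat_of_ord x) (erefl (nat_of_ord x)) => k xE nE.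
by subst n; apply: descent_number_split.
Qed.

(** * Divisibility and parity of the toggled sums *)

Lemma dvdn_descent_number_toggle (l e n : nat) (x : 'I_n) (S : {set 'I_n}) :
  prime l -> S \subset positions n -> n %% l ^ e < x %% l ^ e ->
  l %| descent_number S + descent_number (toggle x S).
Proof.
move=> l_prime /(nat_ord_split x)[S1 [S2 [_ _ ->]]] lt_nx.
by apply: dvdn_mulr; apply: dvdn_bin_ltn_mod lt_nx.
Qed.

(* Every position is non-essential for 2^m in base 2, so toggling preserves the
   parity, and the descent number of the empty set is 1. *)
Lemma odd_descent_number (n m : nat) (S : {set 'I_n}) :
  n = 2 ^ m -> S \subset positions n -> odd (descent_number S).
Proof.
move=> nE; move: {2}#|S| (erefl #|S|) => c; elim: c S => [|c IHc] S cardS S_pos.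
  by rewrite (cards0_eq cardS) descent_number_set0.
have /card_gt0P[x Sx] : 0 < #|S| by rewrite cardS.
have x_gt0 : 0 < x by have := subsetP S_pos _ Sx; rewrite inE.
have lt_nx : n %% 2 ^ m < x %% 2 ^ m by rewrite -nE modnn modn_small.
have odd_toggle : odd (descent_number (toggle x S)).
  apply: IHc; last by rewrite toggle_positions.
  by apply/eqP; rewrite /toggle Sx -eqSS -cardS (cardsD1 x S) Sx.
have := dvdn_descent_number_toggle (isT : prime 2) S_pos lt_nx.
by rewrite dvdn2 oddD odd_toggle; case: odd.
Qed.

(** Cutting at [2 ^ a] leaves two halves whose lengths are powers of 2, so their descent numbers are
    odd; and since [2 ^ b] exceeds [2 ^ a], the binomial is congruent to ['C(2 ^ a, 2 ^ a) = 1]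
    modulo 2. *)
Lemma odd_descent_number_toggle (n a b : nat) (x : 'I_n) (S : {set 'I_n}) :
  a < b -> n = 2 ^ b + 2 ^ a -> x = 2 ^ a :> nat -> S \subset positions n ->
  odd (descent_number S + descent_number (toggle x S)).
Proof.
move=> lt_ab nE xE /(nat_ord_split x)[S1 [S2 [S1_pos S2_pos ->]]].
have nxE : n - x = 2 ^ b by rewrite xE nE addnK.
rewrite !oddM (odd_descent_number xE) // (odd_descent_number nxE) // !andbT.
have := bin_add_pfactor b (2 ^ a) (2 ^ a) (isT : prime 2).
by rewrite -nE -xE binn xE leqNgt ltn_exp2l // lt_ab !modn2; case: odd.
Qed.

(* Toggling both x and y flips the parity of the descent number and preserves it
   modulo p, hence shifts it by an odd multiple of p. *)
Lemma dvdp_descent_set_poly (p n : nat) (x y : 'I_n) :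
  odd p -> 0 < x -> 0 < y ->
  (forall S : {set 'I_n}, S \subset positions n ->
    [/\ p %| descent_number S + descent_number (toggle x S),
        p %| descent_number S + descent_number (toggle y S),
        odd (descent_number S + descent_number (toggle x S))
      & ~~ odd (descent_number S + descent_number (toggle y S))]) ->
  ('X^p + 1 %| descent_set_poly n)%R.
Proof.
move=> p_odd x_gt0 y_gt0 toggleP.
(* With v = u + qp and q odd, the sum is X^u (1 + X^(pq)), and 1 + X^(pq) = (X^p)^q - (-1)^q is
   divisible by X^p + 1. *)
have pair (u v : nat) : p %| v - u -> odd (u + v) -> u <= v ->
    ('X^p + 1 %| ('X^u + 'X^v : {poly rat}))%R.
  move=> /dvdnP[q vuE] odd_uv le_uv.
  have q_odd : odd q.
    by have := oddB le_uv; rewrite vuE oddM p_odd andbT addbC -oddD => ->.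
  rewrite -(subnKC le_uv) vuE exprD -[X in (_ %| X + _)%R]mulr1 -mulrDr.
  rewrite dvdp_mull // mulnC exprM.
  have -> : (1 + ('X^p) ^+ q = ('X^p) ^+ q - (-1) ^+ q :> {poly rat})%R.
    by rewrite -signr_odd q_odd expr1 opprK addrC.
  by rewrite subrXX opprK dvdp_mulr.
pose h S := toggle y (toggle x S).
have h_pos S : (h S \subset positions n) = (S \subset positions n).
  by rewrite !toggle_positions.
have h_inj : injective h.
  by apply: (can_inj (g := h)) => S; rewrite /h (toggleC x y) toggleK toggleK.
(* Doubling the polynomial lets each [S] be paired with [h S] without choosing orbit
   representatives. *)
have two_neq0 : (2%:R != 0 :> rat)%R by [].
rewrite -(dvdpZr _ _ two_neq0) scaler_nat mulr2n.
rewrite {2}/descent_set_poly (reindex_inj h_inj) /=.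
under [X in (_ %| _ + X)%R]eq_bigl do rewrite h_pos.
rewrite -big_split /=; elim/big_ind: _ => [||S S_pos]; first exact: dvdp0.
  exact: dvdp_add.
have [p_x _ odd_x _] := toggleP _ S_pos.
have [|_ p_y _ odd_y] := toggleP (toggle x S).
  by rewrite toggle_positions.
move: p_x odd_x p_y odd_y; rewrite -/(h S).
move: (descent_number S) (descent_number (toggle x S)) (descent_number (h S)).
move=> u w v p_uw odd_uw p_wv odd_wv.
have uv_odd : odd (u + v).
  by move: odd_uw odd_wv; rewrite !oddD; do 3 case: odd.
(* Both [u] and [v] are congruent to [-w] modulo [p]. *)
have eq_uv : u = v %[mod p].
  apply/eqP; rewrite -(eqn_modDr w) [v + w]addnC.
  by rewrite (eqP p_uw) (eqP p_wv).
have [le_uv | /ltnW le_vu] := leqP u v.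
  by rewrite pair // -eqn_mod_dvd // eq_uv.
by rewrite addrC pair // 1?addnC // -eqn_mod_dvd // eq_uv.
Qed.

(** * Residues of [n], [2 ^ a] and [2 * p - 1] *)

Lemma nonessential_ltn_mod (l n k : nat) :
  0 < k < n -> n %% l < k %% l -> nonessential l n k.
Proof.
move=> kn lt_nk; split=> // -[_ /(_ 0)].
by rewrite /digit expn0 !divn1 leqNgt lt_nk.
Qed.

Theorem theorem5p7 (p g a b n : nat) (two : {unit 'F_p})
    (p_prime : prime p) (p_odd : odd p)
    (twoE : FinRing.uval two = 2%:R%R)
    (order_two : #[two]%g = g) (g_even : ~~ odd g)
    (lt_ab : a < b) (nE : n = 2 ^ b + 2 ^ a) (lt_pn : 2 * p - 1 < n)
    (aE : a = g./2 %[mod g]) (bE : b = g./2 %[mod g]) :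
  [/\ nonessential p n (2 ^ a),
      nonessential 2 n (2 * p - 1),
      nonessential p n (2 * p - 1)
    & (cyclotomic_rat (2 * p) %| descent_set_poly n)%R].
Proof.
have p_gt2 : 2 < p by apply: odd_prime_gt2.
have p_gt0 : 0 < p by apply: ltnW (ltnW _).
have g_gt0 : 0 < g by rewrite -order_two order_gt0.
have gE : g./2.*2 = g by rewrite -[RHS]odd_double_half (negbTE g_even).
have h_gt0 : 0 < g./2 by rewrite -double_gt0 gE.
have lt_hg : g./2 < g.
  by rewrite -[X in _ < X]gE -addnn -[X in X < _]addn0 ltn_add2l.
(* The prime [p] divides 2^g - 1 = (2^(g/2) - 1)(2^(g/2) + 1), but not the first factor, since g/2
   is less than the order of 2. *)
have half_pow : p %| 2 ^ g./2 + 1.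
  have := modn_expn_eq1 g p_prime twoE; rewrite order_two dvdnn.
  have := modn_expn_eq1 g./2 p_prime twoE; rewrite order_two gtnNdvd //.
  rewrite !eqn_mod_dvd ?expn_gt0 // => /negbT ndvd.
  rewrite -{1}gE -muln2 expnM -[X in _ - X](exp1n 2) subn_sqr Euclid_dvdM //.
  by rewrite (negbTE ndvd).
have half_powE c : c = g./2 %[mod g] -> 2 ^ c = p.-1 %[mod p] /\ 0 < c.
  move=> cE; split; last first.
    rewrite lt0n; apply/eqP => c0; move: cE h_gt0.
    by rewrite c0 mod0n modn_small // => <-.
  have pow_g : 2 ^ g = 1 %[mod p].
    by apply/eqP; rewrite (modn_expn_eq1 g p_prime twoE) order_two.
  rewrite (divn_eq c g) cE (modn_small lt_hg) expnD (mulnC _ g) expnM.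
  have -> : (2 ^ g) ^ (c %/ g) * 2 ^ g./2 = 2 ^ g./2 %[mod p].
    by rewrite -modnMml -modnXm pow_g modnXm exp1n modnMml mul1n.
  by apply/eqP; rewrite -(eqn_modDr 1) [p.-1 + 1]addn1 prednK // modnn.
have [powa a_gt0] := half_powE _ aE; have [powb b_gt0] := half_powE _ bE.
(* Both powers of 2 are -1 modulo [p], so [n] is -2, whereas [2 ^ a] and [2 * p - 1] are -1: their
   units digit in base [p] exceeds that of [n] by one. *)
have modn_p : n %% p = p.-2.
  rewrite nE -modnDm powa powb modnDm.
  have -> : p.-1 + p.-1 = p + p.-2.
    by case: (p) p_gt2 => [|[|q]] //= _; rewrite addnS addSn.
  by rewrite modnDl modn_small // (leq_ltn_trans (leq_pred _)) // ltn_predL.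
have mod_a : 2 ^ a %% p = p.-1 by rewrite powa modn_small // ltn_predL.
have kE : 2 * p - 1 = p + p.-1 by rewrite mul2n -addnn -addnBA // subn1.
have mod_k : (2 * p - 1) %% p = p.-1.
  by rewrite kE modnDl modn_small // ltn_predL.
have p2_lt : p.-2 < p.-1 by case: (p) p_gt2 => [|[|]].
have lt_a : n %% p < 2 ^ a %% p by rewrite modn_p mod_a.
have lt_k : n %% p < (2 * p - 1) %% p by rewrite modn_p mod_k.
(* As [a] and [b] are positive, [n] is even, while [2 * p - 1] is odd. *)
have lt_k2 : n %% 2 < (2 * p - 1) %% 2.
  rewrite !modn2 nE oddD !oddX !gtn_eqF //= kE oddD.
  by rewrite -[in odd p](prednK p_gt0) /=; case: odd.
have a_n : 0 < 2 ^ a < n.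
  by rewrite expn_gt0 /= nE -{1}[2 ^ a]add0n ltn_add2r expn_gt0.
have k_n : 0 < 2 * p - 1 < n by rewrite lt_pn andbT kE addn_gt0 p_gt0.
split; try exact: nonessential_ltn_mod.
apply: dvdp_trans (cyclotomic_rat_dvd_XnD1 p_gt0) _.
case/andP: a_n => a_pos a_lt; case/andP: k_n => k_pos k_lt.
apply: (@dvdp_descent_set_poly _ _ (Ordinal a_lt) (Ordinal k_lt)) => // S S_pos.
split.
- by apply: (@dvdn_descent_number_toggle _ 1); rewrite ?expn1.
- by apply: (@dvdn_descent_number_toggle _ 1); rewrite ?expn1.
- exact: (odd_descent_number_toggle lt_ab).
by rewrite -dvdn2; apply: (@dvdn_descent_number_toggle _ 1); rewrite ?expn1.
Qed.
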